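(* Let $n\ge 2$ and let $S$ be an arbitrary subset of $Z^{2n}(\pi)$. Put $$\sigma(S)=\inf_{\varphi}\,\sup_{x\in\mathbb{R}^{2n-2}}\overline{\mu}\big(p(\varphi(S)\cap D_x)\big),\qquad \hat\sigma(S)=\inf_{\varphi}\,\sup_{x\in\mathbb{R}^{2n-2}}\hat\mu\big(p(\varphi(S)\cap D_x)\big),$$ where $\varphi$ varies over all symplectic embeddings of $S$ into $Z^{2n}(\pi)$. Then: (i) $\sigma(S)=0$. (ii) $\hat\sigma(S)=0$ if $S\subset Z^{2n}(a)$ for some $a<\pi$.
   Context: $\mathbb{R}^{2n}$ has coordinates $(x_1,y_1,\dots,x_n,y_n)$ and carries the standard symplectic form $\omega_0=\sum_{i=1}^n dx_i\wedge dy_i$. A $C^\infty$-smooth embedding $\varphi$ of an open subset of $\mathbb{R}^{2n}$ into $\mathbb{R}^{2n}$ is called symplectic if $\varphi^*\omega_0=\omega_0$. An embedding of an arbitrary subset $S\subset\mathbb{R}^{2n}$ into a subset $S'\subset\mathbb{R}^{2n}$ is called symplectic if it extends to a symplectic embedding of a neighbourhood of $S$ into $\mathbb{R}^{2n}$. $B^2(\pi r^2)\subset\mathbb{R}^2$ denotes the closed disc of radius $r$ centred at the origin (so $B^2(a)$ has area $a$), $Z^{2n}(a)=B^2(a)\times\mathbb{R}^{2n-2}$ is the closed symplectic cylinder, $p\colon Z^{2n}(\pi)\to B^2(\pi)$ is the projection to the first factor, and $D_x=B^2(\pi)\times\{x\}$ for $x\in\mathbb{R}^{2n-2}$. $\mu$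 is Lebesgue measure on $\mathbb{R}^2$ and $\overline{\mu}$ is outer Lebesgue measure on $\mathbb{R}^2$. For $T\subset\mathbb{R}^2$ the simply connected hull $\widehat T$ is the union of the closure $\overline T$ and the bounded components of $\mathbb{R}^2\setminus\overline T$, and $\hat\mu(T)=\mu(\widehat T)$. *)

(* Defs.v *)
From HB Require Import structures.
From mathcomp Require Import all_boot all_order all_algebra.
From mathcomp Require Import all_classical all_reals all_analysis.

Set Implicit Arguments.
Unset Strict Implicit.
Unset Printing Implicit Defensive.

Import Order.TTheory GRing.Theory Num.Theory.
Import numFieldNormedType.Exports.

Local Open Scope classical_set_scope.
Local Open Scope ring_scope.

Section Smooth.
Context {R : realType} {V W : normedModType R}.

(* For open U in a finite-dimensional V this is the usual C^k: f is
   differentiable on U and all its directional derivatives are C^(k-1). *)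
Fixpoint Ck (k : nat) (U : set V) (f : V -> W) : Prop :=
  if k is k'.+1 then
    (forall z, U z -> differentiable f z) /\ (forall v : V, Ck k' U ('D_v f))
  else forall z, U z -> {for z, continuous f}.

Definition smooth (U : set V) (f : V -> W) : Prop := forall k, Ck k U f.

(* An injective immersion that is a homeomorphism onto its image; the inverse
   psi is continuous for the subspace topology of the image. *)
Definition smooth_embedding (U : set V) (f : V -> W) : Prop :=
  [/\ smooth U f,
      forall z, U z -> injective ('d f z)
    & exists psi : W -> V,
        {in U, cancel f psi} /\ {within f @` U, continuous psi}].

End Smooth.

Section Symplectic.
Context {R : realType}.

(* The k-th coordinate, counted from 0; it is 0 when k >= m, a case that does
   not occur below when n >= 1. *)
Definition nth_coord m (z : 'rV[R]_m) (k : nat) : R :=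
  if insub k is Some i then z ord0 i else 0.

(* R^(2n) is 'rV_(2 * n) with coordinates (x_0, y_0, ..., x_(n-1), y_(n-1)). *)
Definition xcoord n (z : 'rV[R]_(2 * n)) (i : nat) : R :=
  nth_coord z (2 * i)%N.
Definition ycoord n (z : 'rV[R]_(2 * n)) (i : nat) : R :=
  nth_coord z ((2 * i).+1)%N.

Definition omega0 n (u v : 'rV[R]_(2 * n)) : R :=
  \sum_(i < n) (xcoord u i * ycoord v i - xcoord v i * ycoord u i).

Definition symplectic_embedding n (U : set 'rV[R]_(2 * n))
    (phi : 'rV[R]_(2 * n) -> 'rV[R]_(2 * n)) : Prop :=
  smooth_embedding U phi /\
  (forall z, U z -> forall u v,
     omega0 ('d phi z u) ('d phi z v) = omega0 u v).

(* Symplectic embeddings of an arbitrary set S into S'; only the values of phi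
   on S are constrained. *)
Definition symplectic_embedding_into n (S S' : set 'rV[R]_(2 * n))
    (phi : 'rV[R]_(2 * n) -> 'rV[R]_(2 * n)) : Prop :=
  phi @` S `<=` S' /\
  exists (U : set 'rV[R]_(2 * n)) (Phi : 'rV[R]_(2 * n) -> 'rV[R]_(2 * n)),
    [/\ open U, S `<=` U, symplectic_embedding U Phi & {in S, Phi =1 phi}].

(* The closed disc of area a, i.e. of radius r with a = pi * r ^+ 2; it is
   empty when a < 0. *)
Definition disc (a : R) : set (R * R) :=
  [set w | w.1 ^+ 2 + w.2 ^+ 2 <= a / pi].

(* The splitting R^(2n) = R^2 x R^(2n-2). *)
Definition base_proj n (z : 'rV[R]_(2 * n)) : R * R :=
  (xcoord z 0, ycoord z 0).
Definition fiber_proj n (z : 'rV[R]_(2 * n)) : 'rV[R]_(2 * n - 2) :=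
  \row_(j < 2 * n - 2) nth_coord z (j + 2)%N.

Definition cylinder n (a : R) : set 'rV[R]_(2 * n) :=
  [set z | disc a (base_proj z)].

Definition disc_at n (x : 'rV[R]_(2 * n - 2)) : set 'rV[R]_(2 * n) :=
  [set z | disc pi (base_proj z) /\ fiber_proj z = x].

Definition mu2 : set (measurableTypeR R * measurableTypeR R) -> \bar R :=
  (@lebesgue_measure R \x @lebesgue_measure R)%E.

(* The outer measure induced by mu2. *)
Definition outer_mu2 : set (measurableTypeR R * measurableTypeR R) -> \bar R :=
  (mu2^*)%mu.

Definition components (A : set (R * R)) : set (set (R * R)) :=
  [set connected_component A w | w in A].

Definition sc_hull (T : set (R * R)) : set (R * R) :=
  closure T `|`
  \bigcup_(C in components (~` closure T) `&` bounded_set) C.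

(* sc_hull T is closed, hence Borel. *)
Definition sc_hull_mu (T : set (R * R)) : \bar R := mu2 (sc_hull T).

Definition base_section n (phi : 'rV[R]_(2 * n) -> 'rV[R]_(2 * n))
    (S : set 'rV[R]_(2 * n)) (x : 'rV[R]_(2 * n - 2)) : set (R * R) :=
  @base_proj n @` (phi @` S `&` disc_at x).

Definition inf_sup n (nu : set (R * R) -> \bar R)
    (S : set 'rV[R]_(2 * n)) : \bar R :=
  ereal_inf
    [set ereal_sup
           [set nu (base_section phi S x) | x in [set: 'rV[R]_(2 * n - 2)]]
    | phi in symplectic_embedding_into S (@cylinder n pi)].

Definition sigma n (S : set 'rV[R]_(2 * n)) : \bar R :=
  inf_sup outer_mu2 S.
Definition sigma_hat n (S : set 'rV[R]_(2 * n)) : \bar R :=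
  inf_sup sc_hull_mu S.

End Symplectic.

Arguments cylinder {R} n a.

(* Main.v *)
(** Write (x, y) and (u, v) for the first two pairs of coordinates. The
    symplectic map U = atan u, V = (1 + u^2) v confines the coordinate U to an
    interval of length pi. Compose it with a flow that moves the base point in
    a way depending on V and in exchange shifts U by a function G of the base
    point and V. On a fiber, U and V are fixed after the flow, so that G is
    confined to an interval of length pi.
    For (i) rotate the base by the angle k V: then G = - k (x^2 + y^2) / 2, and
    the section lies in an annulus of area O(1 / k).
    For (ii) translate the base by d exp(i w V), where d is so small that the
    disc of area a stays in the disc of area pi: then G is - w d times a linear
    form of norm 1, and the section lies in a strip of width pi / (w d). The
    intersection of the strip with a square is convex, so that it also contains
    the simply connected hull. *)

Require Import Defs.
From mathcomp Require Import all_boot all_order all_algebra.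
From mathcomp Require Import all_classical all_reals all_analysis.
From mathcomp Require Import zify ring lra measurable_realfun.

Set Implicit Arguments.
Unset Strict Implicit.
Unset Printing Implicit Defensive.

Import Order.TTheory GRing.Theory Num.Theory.
Import numFieldNormedType.Exports.

Local Open Scope classical_set_scope.
Local Open Scope ring_scope.

(** * Differential calculus and a class of smooth functions *)

Section ElementaryFunctions.
Context {R : realType}.

(** The chain rule in the form needed for [sin], [cos], [atan] and [tan], whose derivatives are
    known as one-variable [is_derive] facts. *)
Lemma is_diff_comp_derive (V : normedModType R) (f df : V -> R) (g : R -> R)
    (z : V) (g' : R) :
  is_diff z f df -> is_derive (f z) 1 g g' ->
  is_diff z (fun w => g (f w)) (fun v => g' * df v).
Proof.
move=> dfz dgz.
have dg : differentiable g (f z) by apply/derivable1_diffP; case: dgz.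
have Dg : 'd g (f z) = (fun h => g' * h) :> (R -> R).
  apply/funext => h; have -> : h = h *: (1 : R) by rewrite scaler1.
  by rewrite linearZ /= -deriveE// (@derive_val _ _ _ _ _ _ _ dgz) scaler1 mulrC.
have {Dg}dgz' : is_diff (f z) g (fun h => g' * h) by apply: DiffDef.
exact: (is_diff_comp dfz dgz').
Qed.

Lemma is_diff_coord m (i : 'I_m) (z : 'rV[R]_m) :
  is_diff z (fun w : 'rV[R]_m => w ord0 i) (fun v => v ord0 i).
Proof.
apply: DiffDef; first exact: differentiable_coord.
apply/funext => v; rewrite -deriveE; last exact: differentiable_coord.
rewrite /derive; apply: cvg_lim => //.
apply: cvg_near_cst; near=> h.
rewrite /= !mxE addrK /GRing.scale /= mulrA mulVf ?mul1r//.
by near: h; exact: nbhs_dnbhs_neq.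
Unshelve. all: by end_near. Qed.

Lemma is_diff_sum (V W : normedModType R) m (f df : 'I_m -> V -> W) (z : V) :
  (forall i, is_diff z (f i) (df i)) ->
  is_diff z (fun w => \sum_(i < m) f i w) (fun v => \sum_(i < m) df i v).
Proof.
move=> h.
have -> : (fun w => \sum_(i < m) f i w) = \sum_(i < m) f i.
  by apply/funext => w; rewrite fct_sumE.
have -> : (fun w => \sum_(i < m) df i w) = \sum_(i < m) df i.
  by apply/funext => w; rewrite fct_sumE.
elim/big_ind2 : _ => //; first exact: (is_diff_cst 0).
by move=> *; exact: is_diffD.
Qed.

Lemma is_diff_row (V : normedModType R) m (f df : 'I_m -> V -> R) (z : V) :
  (forall i, is_diff z (f i) (df i)) ->
  is_diff z (fun w => \row_i f i w) (fun v => \row_i df i v).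
Proof.
move=> h.
have rowE (g : 'I_m -> V -> R) :
    (fun w => \row_i g i w) = (fun w => \sum_i g i w *: delta_mx (ord0 : 'I_1) i).
  by apply/funext => w; rewrite [LHS]row_sum_delta; apply: eq_bigr => i _; rewrite mxE.
rewrite !rowE; apply: is_diff_sum => i.
exact: (is_diff_comp (h i) (is_diff_scalel (f i z) (delta_mx (ord0 : 'I_1) i))).
Qed.

(* This class contains the coordinates of the maps used below and is closed
   under directional derivatives, which makes smoothness an induction on k. *)
Inductive elementary m : ('rV[R]_m -> R) -> Prop :=
| elementary_cst c : elementary (fun=> c)
| elementary_coord i : elementary (fun z : 'rV[R]_m => z ord0 i)
| elementaryD f g : elementary f -> elementary g ->
    elementary (fun z => f z + g z)
| elementaryM f g : elementary f -> elementary g ->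
    elementary (fun z => f z * g z)
| elementary_sin f : elementary f -> elementary (fun z => sin (f z))
| elementary_cos f : elementary f -> elementary (fun z => cos (f z))
| elementary_atan f : elementary f -> elementary (fun z => atan (f z))
| elementary_inv f : elementary f -> elementary (fun z => (1 + f z ^+ 2)^-1).

Lemma elementaryN m (f : 'rV[R]_m -> R) :
  elementary f -> elementary (fun z => - f z).
Proof.
move=> ef; under eq_fun do rewrite -mulN1r.
by apply: elementaryM => //; exact: elementary_cst.
Qed.

Lemma elementaryX m (f : 'rV[R]_m -> R) k :
  elementary f -> elementary (fun z => f z ^+ k).
Proof.
move=> ef; elim: k => [|k IH]; first exact: elementary_cst.
by under eq_fun do rewrite exprS; apply: elementaryM.
Qed.

Lemma is_derive_inv1sqr (x : R) :
  is_derive x 1 (fun t => (1 + t ^+ 2)^-1) (- (2 * x) * (1 + x ^+ 2)^-1 ^+ 2).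
Proof.
have x0 : 1 + x ^+ 2 != 0 by rewrite gt_eqF// ltr_pwDl// sqr_ge0.
apply: is_derive_eq.
rewrite /GRing.scale /= !mulr1 !add0r; field.
by move: x0; rewrite expr2.
Qed.

Lemma elementary_diff m (f : 'rV[R]_m -> R) : elementary f ->
  exists2 df : 'rV[R]_m -> 'rV[R]_m -> R,
    forall z, is_diff z f (df z) & forall v, elementary (df ^~ v).
Proof.
elim=> {f}.
- by move=> c; exists (fun _ _ => 0) => [z|v]; [exact: is_diff_cst|exact: elementary_cst].
- by move=> i; exists (fun _ v => v ord0 i) => [z|v];
    [exact: is_diff_coord|exact: elementary_cst].
- move=> f g _ [df hf ef] _ [dg hg eg].
  exists (fun z v => df z v + dg z v) => [z|v]; first exact: is_diffD.
  exact: elementaryD.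
- move=> f g Ef [df hf ef] Eg [dg hg eg].
  exists (fun z v => f z * dg z v + g z * df z v) => [z|v]; first exact: is_diffM.
  by apply: elementaryD; exact: elementaryM.
- move=> f Ef [df hf ef].
  exists (fun z v => cos (f z) * df z v) => [z|v]; first exact: is_diff_comp_derive.
  by apply: elementaryM => //; exact: elementary_cos.
- move=> f Ef [df hf ef].
  exists (fun z v => - sin (f z) * df z v) => [z|v]; first exact: is_diff_comp_derive.
  by apply: elementaryM => //; apply: elementaryN; exact: elementary_sin.
- move=> f Ef [df hf ef].
  exists (fun z v => (1 + f z ^+ 2)^-1 * df z v) => [z|v].
    exact: is_diff_comp_derive.
  by apply: elementaryM => //; exact: elementary_inv.
- move=> f Ef [df hf ef].
  exists (fun z v => - (2 * f z) * (1 + f z ^+ 2)^-1 ^+ 2 * df z v) => [z|v].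
    exact: (is_diff_comp_derive (hf z) (is_derive_inv1sqr _)).
  apply: elementaryM => //; apply: elementaryM.
    by apply: elementaryN; apply: elementaryM => //; exact: elementary_cst.
  by apply: elementaryX; exact: elementary_inv.
Qed.

(** Induction on the order, for all rows at once: a directional derivative of a row of elementary
    functions is again such a row. *)
Lemma elementary_row_smooth m p (f : 'I_p -> 'rV[R]_m -> R)
    (U : set 'rV[R]_m) :
  (forall i, elementary (f i)) -> smooth U (fun z => \row_i f i z).
Proof.
move=> ef k; elim: k f ef => [|k IH] f ef.
  move=> z _; apply: differentiable_continuous.
  have df i : is_diff z (f i) ('d (f i) z).
    by have [df hf _] := elementary_diff (ef i); apply: differentiableP; case: (hf z).
  by have := is_diff_row df; case.
have /choice[df hdf] : forall i, exists dfi, (forall z, is_diff z (f i) (dfi z)) /\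
    forall v, elementary (dfi ^~ v).
  by move=> i; have [dfi] := elementary_diff (ef i); exists dfi.
have drow z := is_diff_row (fun i => (hdf i).1 z).
split=> [z _|v]; first by case: (drow z).
have -> : 'D_v (fun z => \row_i f i z) = (fun z => \row_i df i z v).
  apply/funext => z; rewrite deriveE; last by case: (drow z).
  by have drow_z := drow z; rewrite diff_val.
by apply: IH => i; exact: (hdf i).2.
Qed.

End ElementaryFunctions.

(** * Area estimates for thin strips and annuli *)

Section PlaneMeasure.
Context {R : realType}.
Local Notation lambda := (@lebesgue_measure R).

(** The integral of a nonnegative function is a supremum over the simple functions below it, so
    monotonicity holds for arbitrary integrands. This matters for section lengths of arbitrary
    sets. *)
Lemma ge0_le_integralT d (T : measurableType d)
    (mu : {measure set T -> \bar R}) (f g : T -> \bar R) :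
  (forall x, 0 <= f x)%E -> (forall x, f x <= g x)%E ->
  (\int[mu]_x f x <= \int[mu]_x g x)%E.
Proof.
move=> f0 fg; have g0 x : (0 <= g x)%E by exact: le_trans (f0 x) (fg x).
rewrite !ge0_integralTE//; apply: le_ereal_sup => _ [h hf <-]; exists h => //.
by move=> x; exact: le_trans (hf x) (fg x).
Qed.

Lemma le_lebesgue_measure (A B : set R) : A `<=` B -> (lambda A <= lambda B)%E.
Proof.
move=> AB; rewrite /lebesgue_measure /lebesgue_stieltjes_measure.
by rewrite /measure_extension; exact: le_mu_ext.
Qed.

Lemma lebesgue_measure_itvcc_le (A : set R) (a b c : R) : 0 <= c -> b - a <= c ->
  A `<=` `[a, b] -> (lambda A <= c%:E)%E.
Proof.
move=> c0 bac /le_lebesgue_measure/le_trans; apply.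
rewrite lebesgue_measure_itv/= lte_fin; case: ifPn => _; last by rewrite lee_fin.
by rewrite -EFinB lee_fin.
Qed.

Lemma mu2_ge0 (A : set (R * R)) : (0 <= @mu2 R A)%E.
Proof. by apply: integral_ge0 => x _; exact: measure_ge0. Qed.

(** [mu2] integrates the lengths of vertical sections, which here are at most [M] and vanish off
    [[a, b]]. *)
Lemma mu2_le_width (A : set (R * R)) (a b L M : R) :
  0 <= L -> 0 <= M -> b - a <= L ->
  (forall p, A p -> a <= p.1 <= b) ->
  (forall x, (lambda (xsection A x) <= M%:E)%E) -> (@mu2 R A <= (L * M)%:E)%E.
Proof.
move=> L0 M0 baL Aab AM.
have h : (\int[lambda]_x ((cst M%:E) \_ `[a, b]) x <= (L * M)%:E)%E.
  rewrite -integral_mkcond integral_cst//= mulrC EFinM; apply: lee_wpmul2l => //.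
  exact: (lebesgue_measure_itvcc_le L0 baL).
apply: le_trans h; apply: ge0_le_integralT => x /=; first exact: measure_ge0.
rewrite patchE; case: ifPn => [_|xab]; first exact: AM.
suff -> : xsection A x = set0 by rewrite measure0.
apply/seteqP; split => // y /xsectionP/Aab /= xI.
by move: xab; rewrite notin_setE /= in_itv /= xI.
Qed.

(** The width [eta ^+ 2] is balanced against the threshold [eta] for [s]: above it, vertical
    sections have length at most [eta ^+ 2 / s <= eta]; below it, the horizontal extent is
    O([eta]). *)
Lemma mu2_strip_le (A : set (R * R)) (c s m eta : R) :
  c ^+ 2 + s ^+ 2 = 1 -> 0 < eta <= 2^-1 ->
  (forall p, A p -> [/\ -1 <= p.1 <= 1, -1 <= p.2 <= 1
     & m <= c * p.1 + s * p.2 <= m + eta ^+ 2]) ->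
  (@mu2 R A <= (12 * eta)%:E)%E.
Proof.
move=> cs1 /andP[eta0 eta2].
(* Negating the normal vector describes the same strip, with lower bound [- m - eta ^+ 2]. *)
wlog s0 : c s m cs1 / 0 <= s => [hw|] hA.
  have [s0|s0] := leP 0 s; first exact: (hw c s m).
  apply: (hw (- c) (- s) (- m - eta ^+ 2)); first by rewrite !sqrrN.
    by rewrite oppr_ge0 ltW.
  by move=> p /hA[-> -> h]; split=> //; lra.
(* A need not be measurable, so Fubini is not available and only vertical
   sections can be used: they are short when the strip is not too steep, and
   otherwise A projects to a short interval. *)
have [es|se] := leP eta s.
  have s_gt0 : 0 < s by exact: lt_le_trans es.
  apply: (@le_trans _ _ (2 * eta)%:E); last by rewrite lee_fin; lra.
  apply: (@mu2_le_width _ (-1) 1) => //; [lra|lra| |].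
    by move=> p /hA[].
  move=> x; apply: (@lebesgue_measure_itvcc_le _ ((m - c * x) / s)
    ((m + eta ^+ 2 - c * x) / s)); first exact: ltW.
    rewrite -mulrBl ler_pdivrMr//; have : eta * eta <= eta * s by rewrite ler_pM2l.
    by rewrite expr2; lra.
  move=> y /xsectionP/hA[/= _ _ h]; rewrite in_itv /=.
  by rewrite ler_pdivrMr// ler_pdivlMr//; lra.
have c2 : 2^-1 <= `|c|.
  rewrite leNgt; apply/negP => cl.
  have : `|c| ^+ 2 < 2^-1 ^+ 2 by rewrite ltr_pXn2r// nnegrE.
  have : s ^+ 2 <= 2^-1 ^+ 2 by rewrite ler_pXn2r// ?nnegrE; lra.
  by rewrite real_normK ?num_real//; lra.
have c_gt0 : 0 < `|c| by lra.
have secM x : (lambda (xsection A x) <= 2%:E)%E.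
  apply: (@lebesgue_measure_itvcc_le _ (-1) 1); [lra|lra|].
  by move=> y /xsectionP/hA[]; rewrite /= in_itv.
(* Since [s * p.2] lies within [eta] of 0, [c * p.1] ranges over an interval of length [w]. *)
pose w := 2 * eta + eta ^+ 2.
have w6 : 2 * w <= 6 * eta.
  have : eta * eta <= eta * 2^-1 by rewrite ler_pM2l.
  by rewrite /w expr2; lra.
have cx p : A p -> m - eta <= c * p.1 <= m + eta ^+ 2 + eta.
  move=> /hA[_ /andP[p2 p2'] h].
  have : s * p.2 <= s * 1 by rewrite ler_wpM2l.
  have : s * (-1) <= s * p.2 by rewrite ler_wpM2l.
  by lra.
have wc : w / `|c| <= 6 * eta.
  rewrite ler_pdivrMr//; apply: le_trans (_ : 2^-1 * (6 * eta) <= _); first by lra.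
  by rewrite mulrC ler_wpM2l//; lra.
have -> : 12 * eta = 6 * eta * 2 by ring.
have [c0|c0] := leP 0 c.
  rewrite ger0_norm// in wc c_gt0.
  apply: (@mu2_le_width _ ((m - eta) / c) ((m + eta ^+ 2 + eta) / c)) => //.
  - by lra.
  - by rewrite -mulrBl; apply: le_trans wc; rewrite ler_pM2r ?invr_gt0// /w; lra.
  - by move=> p /cx; rewrite ler_pdivrMr// ler_pdivlMr//; lra.
rewrite ltr0_norm// in wc c_gt0.
apply: (@mu2_le_width _ (- (m + eta ^+ 2 + eta) / - c) (- (m - eta) / - c)) => //.
- by lra.
- by rewrite -mulrBl; apply: le_trans wc; rewrite ler_pM2r ?invr_gt0// /w; lra.
- by move=> p /cx; rewrite ler_pdivrMr// ler_pdivlMr//; lra.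
Qed.

(** A vertical section lies in two intervals of length [b - a], and for [a <= b] one has [(b - a) ^+
    2 <= b ^+ 2 - a ^+ 2 <= eta ^+ 2]. *)
Lemma mu2_annulus_le (A : set (R * R)) (m eta : R) : 0 < eta ->
  (forall p, A p -> -1 <= p.1 <= 1 /\
     m <= p.1 ^+ 2 + p.2 ^+ 2 <= m + eta ^+ 2) ->
  (@mu2 R A <= (4 * eta)%:E)%E.
Proof.
move=> eta0 hA; have -> : 4 * eta = 2 * (2 * eta) by ring.
apply: (@mu2_le_width _ (-1) 1) => //; [lra|lra|by move=> p /hA[]|move=> x].
(* [Num.sqrt] is 0 on negative numbers, so [a = 0] is the right inner bound when the vertical line
   misses the hole. *)
pose a := Num.sqrt (m - x ^+ 2); pose b := Num.sqrt (m - x ^+ 2 + eta ^+ 2).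
have a0 : 0 <= a by exact: sqrtr_ge0.
have b0 : 0 <= b by exact: sqrtr_ge0.
have ab : b - a <= eta.
  have [ba|ab] := leP b a; first by lra.
  rewrite -ler_sqr ?nnegrE//; [|by rewrite subr_ge0 ltW|exact: ltW].
  apply: (@le_trans _ _ (b ^+ 2 - a ^+ 2)).
    rewrite subr_sqr expr2 ler_pM2l ?subr_gt0//; lra.
  have b_gt0 : 0 < m - x ^+ 2 + eta ^+ 2 by rewrite -sqrtr_gt0; exact: le_lt_trans ab.
  rewrite sqr_sqrtr; last exact: ltW.
  have [mx|mx] := leP 0 (m - x ^+ 2); first by rewrite sqr_sqrtr//; lra.
  by have := sqr_ge0 a; lra.
apply: (@le_trans _ _ (lambda (`[a, b] `|` `[- b, - a]))).
  apply: le_lebesgue_measure => y /xsectionP/hA[/= _ h].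
  have ay : a <= `|y|.
    by rewrite -sqrtr_sqr; apply: ler_wsqrtr; lra.
  have yb : `|y| <= b.
    by rewrite -sqrtr_sqr; apply: ler_wsqrtr; lra.
  have [y0|y0] := leP 0 y; [left|right]; rewrite /= in_itv /=.
    by rewrite ger0_norm// in ay yb; rewrite ay.
  by rewrite ltr0_norm// in ay yb; lra.
apply: le_trans (measureU2 _ _ _) _ => //.
have -> : (2 * eta)%:E = (eta%:E + eta%:E)%E by rewrite -EFinD; congr EFin; ring.
apply: leeD.
  by apply: (@lebesgue_measure_itvcc_le _ a b) => //; exact: ltW.
by apply: (@lebesgue_measure_itvcc_le _ (- b) (- a)) => //; [exact: ltW|lra].
Qed.

(** [T] is enclosed in a Borel piece of the annulus, on which the outer measure is [mu2]. *)
Lemma outer_mu2_annulus_le (T : set (R * R)) (m eta : R) : 0 < eta ->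
  (forall p, T p -> -1 <= p.1 <= 1 /\
     m <= p.1 ^+ 2 + p.2 ^+ 2 <= m + eta ^+ 2) ->
  (@outer_mu2 R T <= (4 * eta)%:E)%E.
Proof.
move=> eta0 hT.
pose A : set (measurableTypeR R * measurableTypeR R) :=
  (fst @^-1` `[-1, 1]) `&`
  ((fun p => p.1 ^+ 2 + p.2 ^+ 2) @^-1` `[m, m + eta ^+ 2]).
have mA : measurable A.
  apply: measurableI.
    rewrite -[X in measurable X]setTI.
    by apply: (@measurable_fst _ _ (measurableTypeR R) (measurableTypeR R)).
  rewrite -[X in measurable X]setTI.
  suff : measurable_fun [set: measurableTypeR R * measurableTypeR R]
      (fun p => p.1 ^+ 2 + p.2 ^+ 2 : measurableTypeR R) by apply.
  by apply: measurable_funD; apply: measurable_funX;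
    [exact: measurable_fst|exact: measurable_snd].
have hA p : A p -> -1 <= p.1 <= 1 /\ m <= p.1 ^+ 2 + p.2 ^+ 2 <= m + eta ^+ 2.
  by case; rewrite /= !in_itv.
apply: le_trans (mu2_annulus_le eta0 hA).
apply: (@le_trans _ _ (@outer_mu2 R A)).
  by apply: le_mu_ext => p /hT; rewrite /A /= !in_itv => -[].
by rewrite /outer_mu2 measurable_mu_extE.
Qed.

End PlaneMeasure.

(** * The simply connected hull and half-planes *)

Section Hull.
Context {R : realType}.

(* A point beyond the line sees the ray pointing away from the half-plane, so
   it lies in an unbounded component. *)
Lemma sc_hull_halfplane (T : set (R * R)) (a b m : R) :
  (a, b) != (0, 0) -> (forall p, T p -> a * p.1 + b * p.2 <= m) ->
  forall p, sc_hull T p -> a * p.1 + b * p.2 <= m.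
Proof.
move=> ab0 hT.
pose H := [set p : R * R | a * p.1 + b * p.2 <= m].
have contl : continuous (fun p : R * R => a * p.1 + b * p.2 : R).
  by move=> p; apply: cvgD; apply: cvgM; [exact: cvg_cst|exact: cvg_fst|
    exact: cvg_cst|exact: cvg_snd].
have clH : closed H.
  by apply: (@closed_comp _ _ (fun p : R * R => a * p.1 + b * p.2 : R)
    [set y | y <= m]) => [p _|]; [exact: contl|exact: closed_le].
have TH : closure T `<=` H by move/closure_id: clH => ->; exact: closureS.
move=> p [/TH//|[C [[w wT <-] bC] wp]].
rewrite leNgt; apply/negP => mp.
have n0 : 0 < a ^+ 2 + b ^+ 2.
  rewrite lt0r addr_ge0 ?sqr_ge0// andbT paddr_eq0 ?sqr_ge0// !sqrf_eq0.
  by move: ab0; rewrite xpair_eqE.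
pose ray (t : R) : R * R := (p.1 + t * a, p.2 + t * b).
have contr : continuous ray.
  have cl (q e t : R) : q + s * e @[s --> t] --> q + t * e.
    by apply: cvgD; [exact: cvg_cst|apply: cvgM; [exact: cvg_id|exact: cvg_cst]].
  by move=> t; exact: cvg_pair (cl p.1 a t) (cl p.2 b t).
have ray_sub : ray @` `[0, +oo[ `<=` ~` closure T.
  move=> y [t /=]; rewrite in_itv /= andbT => t0 <- /TH; rewrite /H /= => h.
  have : 0 <= t * (a ^+ 2 + b ^+ 2) by rewrite mulr_ge0// ltW.
  by nra.
have wp' : connected_component (~` closure T) p = connected_component (~` closure T) w.
  by apply/esym/same_connected_component.
have ray_comp : ray @` `[0, +oo[ `<=` connected_component (~` closure T) w.
  rewrite -wp'; apply: connected_component_max => //.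
  - by exists 0; [rewrite /= in_itv /= lexx|rewrite /ray !mul0r !addr0 -surjective_pairing].
  - apply: connected_continuous_connected; last exact: continuous_subspaceT.
    exact/connected_intervalP/interval_is_interval.
(* Boundedness gives a norm bound by every number exceeding [M]; the maximum with 1 makes the bound
   positive. *)
have [M [_ /(_ (Num.max 1 (M + 1)))]] := bC.
rewrite lt_max ltrDl ltr01 orbT => /(_ isT) hM.
set N := Num.max 1 (M + 1) in hM.
have N1 : 1 <= N by rewrite le_max lexx.
have rayN t : 0 <= t -> `|p.1 + t * a| <= N /\ `|p.2 + t * b| <= N.
  move=> t0; have : `|ray t| <= N.
    by apply: hM; apply: ray_comp; exists t; rewrite //= in_itv /= t0.
  by rewrite prod_normE /= ge_max => /andP[].
have p0 := rayN 0 (lexx _); rewrite !mul0r !addr0 in p0.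
(* If [e] were nonzero, the time [3 * N / |e|] would displace [q] by [3 * N], but two points of norm
   at most [N] differ by at most [2 * N]. *)
have key (q e : R) : `|q| <= N -> (forall t, 0 <= t -> `|q + t * e| <= N) -> e = 0.
  move=> qN h; apply/eqP; apply: contraT => e0.
  have e1 : 0 < `|e| by rewrite normr_gt0.
  have := h (3 * N / `|e|); rewrite divr_ge0//; last by lra.
  move=> /(_ isT) h3.
  have : `|3 * N / `|e| * e| <= N + N.
    rewrite -[X in `|X|](addKr q) addrC; apply: le_trans (ler_normD _ _) _.
    by rewrite normrN addrC lerD// addrC.
  rewrite normrM normrM normfV normr_id mulfVK ?gt_eqF// ger0_norm; lra.
have a0 : a = 0 by apply: (key p.1); [exact: p0.1|move=> t t0; exact: (rayN t t0).1].
have b0 : b = 0 by apply: (key p.2); [exact: p0.2|move=> t t0; exact: (rayN t t0).2].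
by move: ab0; rewrite a0 b0 eqxx.
Qed.

End Hull.

(** * Coordinates and nondegeneracy of the symplectic form *)

Section Coordinates.
Context {R : realType}.

Lemma nth_coord_row m (f : nat -> R) j : (j < m)%N ->
  nth_coord (\row_(i < m) f i) j = f j.
Proof. by move=> jm; rewrite /nth_coord insubT mxE. Qed.

Lemma nth_coordE m (z : 'rV[R]_m) (i : 'I_m) : nth_coord z i = z ord0 i.
Proof. by rewrite /nth_coord valK. Qed.

Lemma row_nth_coord m (z : 'rV[R]_m) : \row_(i < m) nth_coord z i = z.
Proof. by apply/rowP => i; rewrite mxE nth_coordE. Qed.

Lemma is_diff_nth_coord m j (z : 'rV[R]_m) :
  is_diff z (fun w => nth_coord w j) (fun v => nth_coord v j).
Proof.
rewrite /nth_coord; case: insub => [i|]; first exact: is_diff_coord.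
exact: (is_diff_cst 0).
Qed.

Lemma elementary_nth_coord m j : elementary (fun z : 'rV[R]_m => nth_coord z j).
Proof.
rewrite /nth_coord; case: insub => [i|]; first exact: elementary_coord.
exact: elementary_cst.
Qed.

Lemma differentiable_row (V : normedModType R) m (f : 'I_m -> V -> R) (z : V) :
  (forall i, differentiable (f i) z) -> differentiable (fun w => \row_i f i w) z.
Proof.
by move=> df; case: (is_diff_row (fun i => differentiableP (df i))).
Qed.

Lemma omega0_row {n : nat} (f g : nat -> R) :
  omega0 (\row_(i < 2 * n) f i) (\row_(i < 2 * n) g i) =
  \sum_(i < n) (f (2 * i)%N * g (2 * i).+1 - g (2 * i)%N * f (2 * i).+1).
Proof.
apply: eq_bigr => i _; have := ltn_ord i => hi.
by rewrite /xcoord /ycoord !nth_coord_row//; lia.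
Qed.

(** Pairing with the basis vector of the conjugate coordinate reads off each coordinate up to
    sign. *)
Lemma omega0_nondegenerate n (u1 u2 : 'rV[R]_(2 * n)) :
  (forall v, omega0 u1 v = omega0 u2 v) -> u1 = u2.
Proof.
move=> h; rewrite -[u1]row_nth_coord -[u2]row_nth_coord.
have oE (u : 'rV[R]_(2 * n)) (k : 'I_n) (b : bool) :
    omega0 u (\row_(i < 2 * n) (i == (2 * k + b)%N :> nat)%:R) =
    if b then nth_coord u (2 * k)%N else - nth_coord u (2 * k).+1%N.
  rewrite -{1}[u]row_nth_coord.
  rewrite (omega0_row (nth_coord u) (fun i => (i == (2 * k + b)%N)%:R)).
  rewrite (bigD1 k)//= big1 => [|i ik]; last first.
    have ik' : (i : nat) != k by [].
    rewrite (_ : ((2 * i).+1 == _)%N = false); last by case: b; lia.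
    by rewrite (_ : (2 * i == _)%N = false) ?mulr0 ?mul0r ?subr0//; case: b; lia.
  rewrite addr0; case: b.
    by rewrite addn1 eqxx ltn_eqF// mulr1 mul0r subr0.
  by rewrite addn0 eqxx gtn_eqF// mulr0 mul1r sub0r.
apply/rowP => i; rewrite !mxE.
have hi : (i./2 < n)%N by have := ltn_ord i; lia.
(* The conjugate of the coordinate [i] has the same half and the opposite parity. *)
have := oE u1 (Ordinal hi) (~~ odd i); rewrite h oE /=.
have := odd_double_half i; rewrite -mul2n.
by case: (odd i) => /=; rewrite ?add1n ?add0n => -> // /oppr_inj.
Qed.

End Coordinates.

Ltac elementary_tac := repeat first [assumption
  | exact: elementary_nth_coord | exact: elementary_cst
  | apply: elementaryX | apply: elementaryN
  | apply: elementary_cos | apply: elementary_sin | apply: elementary_atan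
  | apply: elementaryM | apply: elementaryD].

(** * The shear map and its smoothness *)

Section Shear.
Context {R : realType}.

(* The shear is the composition of the symplectic embedding
   (u, v) |-> (atan u, (1 + u^2) v) of the second plane into a strip with the
   flows, at times k and w, of Hamiltonians that depend on the base point and
   on V only: the first rotates the base by the angle k V, the second
   translates it by d exp(i w V). *)
Definition shearV n (z : 'rV[R]_(2 * n)) : R :=
  nth_coord z 3 * (1 + nth_coord z 2 ^+ 2).

Definition rotX n (k : R) (z : 'rV[R]_(2 * n)) : R :=
  cos (k * shearV z) * nth_coord z 0 - sin (k * shearV z) * nth_coord z 1.

Definition rotY n (k : R) (z : 'rV[R]_(2 * n)) : R :=
  sin (k * shearV z) * nth_coord z 0 + cos (k * shearV z) * nth_coord z 1.

Definition shearU n (k d w : R) (z : 'rV[R]_(2 * n)) : R :=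
  atan (nth_coord z 2) - k / 2 * (nth_coord z 0 ^+ 2 + nth_coord z 1 ^+ 2)
  - w * d * (cos (w * shearV z) * rotX k z + sin (w * shearV z) * rotY k z).

Definition shear_coord n (k d w : R) (z : 'rV[R]_(2 * n)) (j : nat) : R :=
  match j with
  | 0 => rotX k z + d * cos (w * shearV z)
  | 1 => rotY k z + d * sin (w * shearV z)
  | 2 => shearU k d w z
  | 3 => shearV z
  | _ => nth_coord z j
  end.

Definition shear n (k d w : R) (z : 'rV[R]_(2 * n)) : 'rV[R]_(2 * n) :=
  \row_(i < 2 * n) shear_coord k d w z i.

Lemma elementary_shearV n : elementary (@shearV n).
Proof.
by rewrite /shearV; do ?[exact: elementary_nth_coord | exact: elementary_cst
  | apply: elementaryM | apply: elementaryD | apply: elementaryX].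
Qed.

Lemma elementary_rotX n k : elementary (@rotX n k).
Proof. have := @elementary_shearV n; rewrite /rotX => EV; elementary_tac. Qed.

Lemma elementary_rotY n k : elementary (@rotY n k).
Proof. have := @elementary_shearV n; rewrite /rotY => EV; elementary_tac. Qed.

Lemma elementary_shear_coord n k d w j :
  elementary (fun z : 'rV[R]_(2 * n) => shear_coord k d w z j).
Proof.
have EV := @elementary_shearV n.
move: j => [|[|[|[|j]]]] /=; rewrite ?/shearU.
- by apply: elementaryD; [exact: elementary_rotX|elementary_tac].
- by apply: elementaryD; [exact: elementary_rotY|elementary_tac].
- apply: elementaryD; first by elementary_tac.
  apply: elementaryN; apply: elementaryM; first by elementary_tac.
  apply: elementaryD; apply: elementaryM; first by elementary_tac.
  + exact: elementary_rotX.
  + by elementary_tac.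
  + exact: elementary_rotY.
- exact: elementary_shearV.
- by elementary_tac.
Qed.

Lemma shear_smooth n (k d w : R) (U : set 'rV[R]_(2 * n)) :
  smooth U (shear k d w).
Proof.
by apply: elementary_row_smooth => i; exact: elementary_shear_coord.
Qed.

Lemma rot_norm n (k : R) (z : 'rV[R]_(2 * n)) :
  rotX k z ^+ 2 + rotY k z ^+ 2 = nth_coord z 0 ^+ 2 + nth_coord z 1 ^+ 2.
Proof.
rewrite /rotX /rotY; have := cos2Dsin2 (k * shearV z).
move: (cos _) (sin _) => C S CS.
transitivity ((C ^+ 2 + S ^+ 2) * (nth_coord z 0 ^+ 2 + nth_coord z 1 ^+ 2)).
  by ring.
by rewrite CS mul1r.
Qed.

End Shear.

(** * The differential of the shear preserves the symplectic form *)

Section ShearSymplectic.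
Context {R : realType}.

(** This and the next rules are in pointwise form, so that differentials of explicit expressions can
    be assembled term by term. *)
Lemma is_diff_addf (V : normedModType R) (f g df dg : V -> R) (z : V) :
  is_diff z f df -> is_diff z g dg ->
  is_diff z (fun w => f w + g w) (fun v => df v + dg v).
Proof. exact: is_diffD. Qed.

Lemma is_diff_mulf (V : normedModType R) (f g df dg : V -> R) (z : V) :
  is_diff z f df -> is_diff z g dg ->
  is_diff z (fun w => f w * g w) (fun v => f z * dg v + g z * df v).
Proof. exact: is_diffM. Qed.

Lemma is_diff_oppf (V : normedModType R) (f df : V -> R) (z : V) :
  is_diff z f df -> is_diff z (fun w => - f w) (fun v => - df v).
Proof. exact: is_diffN. Qed.

Lemma is_diff_sqrf (V : normedModType R) (f df : V -> R) (z : V) :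
  is_diff z f df -> is_diff z (fun w => f w ^+ 2) (fun v => 2 * f z * df v).
Proof.
move=> dfz; apply: (is_diff_eq (is_diff_mulf dfz dfz)).
by apply/funext => v; ring.
Qed.

Definition dshearV n (z h : 'rV[R]_(2 * n)) : R :=
  (1 + nth_coord z 2 ^+ 2) * nth_coord h 3
  + 2 * nth_coord z 2 * nth_coord z 3 * nth_coord h 2.

Definition drotX n (k : R) (z h : 'rV[R]_(2 * n)) : R :=
  cos (k * shearV z) * nth_coord h 0 - sin (k * shearV z) * nth_coord h 1
  - k * rotY k z * dshearV z h.

Definition drotY n (k : R) (z h : 'rV[R]_(2 * n)) : R :=
  sin (k * shearV z) * nth_coord h 0 + cos (k * shearV z) * nth_coord h 1
  + k * rotX k z * dshearV z h.

Definition dshear_coord n (k d w : R) (z h : 'rV[R]_(2 * n)) (j : nat) : R :=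
  let c := cos (w * shearV z) in let s := sin (w * shearV z) in
  match j with
  | 0 => drotX k z h - d * w * s * dshearV z h
  | 1 => drotY k z h + d * w * c * dshearV z h
  | 2 => (1 + nth_coord z 2 ^+ 2)^-1 * nth_coord h 2
    - k * (nth_coord z 0 * nth_coord h 0 + nth_coord z 1 * nth_coord h 1)
    - w * d * (c * drotX k z h + s * drotY k z h
               + w * (c * rotY k z - s * rotX k z) * dshearV z h)
  | 3 => dshearV z h
  | _ => nth_coord h j
  end.

Lemma is_diff_shear_coord n (k d w : R) (z : 'rV[R]_(2 * n)) j :
  is_diff z (fun y => shear_coord k d w y j)
            (fun h => dshear_coord k d w z h j).
Proof.
have D0 := is_diff_nth_coord 0 z; have D1 := is_diff_nth_coord 1 z.
have D2 := is_diff_nth_coord 2 z; have D3 := is_diff_nth_coord 3 z.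
have Dc (c : R) : is_diff z (fun=> c) (fun=> 0) := is_diff_cst c z.
have DV : is_diff z (@shearV R n) (dshearV z).
  apply: (is_diff_eq (is_diff_mulf D3 (is_diff_addf (Dc 1) (is_diff_sqrf D2)))).
  by apply/funext => h; rewrite /dshearV; ring.
have Dcos a : is_diff z (fun y => cos (a * shearV y))
    (fun h => - sin (a * shearV z) * (a * dshearV z h)).
  apply: (is_diff_eq (is_diff_comp_derive (is_diff_mulf (Dc a) DV) (is_derive_cos _))).
  by apply/funext => h; ring.
have Dsin a : is_diff z (fun y => sin (a * shearV y))
    (fun h => cos (a * shearV z) * (a * dshearV z h)).
  apply: (is_diff_eq (is_diff_comp_derive (is_diff_mulf (Dc a) DV) (is_derive_sin _))).
  by apply/funext => h; ring.
have DX : is_diff z (rotX k) (drotX k z).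
  apply: (is_diff_eq (is_diff_addf (is_diff_mulf (Dcos k) D0)
    (is_diff_oppf (is_diff_mulf (Dsin k) D1)))).
  by apply/funext => h; rewrite /drotX /rotY; ring.
have DY : is_diff z (rotY k) (drotY k z).
  apply: (is_diff_eq (is_diff_addf (is_diff_mulf (Dsin k) D0)
    (is_diff_mulf (Dcos k) D1))).
  by apply/funext => h; rewrite /drotY /rotX; ring.
move: j => [|[|[|[|j]]]] //=.
- apply: (is_diff_eq (is_diff_addf DX (is_diff_mulf (Dc d) (Dcos w)))).
  by apply/funext => h; ring.
- apply: (is_diff_eq (is_diff_addf DY (is_diff_mulf (Dc d) (Dsin w)))).
  by apply/funext => h; ring.
- apply: (is_diff_eq (is_diff_addf (is_diff_addf
    (is_diff_comp_derive D2 (is_derive1_atan _))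
    (is_diff_oppf (is_diff_mulf (Dc (k / 2))
      (is_diff_addf (is_diff_sqrf D0) (is_diff_sqrf D1)))))
    (is_diff_oppf (is_diff_mulf (Dc (w * d))
      (is_diff_addf (is_diff_mulf (Dcos w) DX) (is_diff_mulf (Dsin w) DY)))))).
  apply/funext => h; move: (1 + nth_coord z 2 ^+ 2)^-1 => iu.
  by field.
- exact: is_diff_nth_coord.
Qed.

Lemma diff_shear n (k d w : R) (z h : 'rV[R]_(2 * n)) :
  'd (shear k d w) z h = \row_(i < 2 * n) dshear_coord k d w z h i.
Proof.
have D := is_diff_row (fun i : 'I_(2 * n) => is_diff_shear_coord k d w z i).
by rewrite /shear diff_val.
Qed.

(** From the third pair on, the map is the identity. On the first two pairs the terms in [d] and [w]
    cancel between the base and U, and the rest follows from cos^2 + sin^2 = 1 for the rotation and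
    from the reciprocal factors in atan u and (1 + u^2) v. *)
Lemma shear_omega0 n (k d w : R) (z h g : 'rV[R]_(2 * n)) : (2 <= n)%N ->
  omega0 ('d (shear k d w) z h) ('d (shear k d w) z g) = omega0 h g.
Proof.
move: n z h g => [|[|n]] // z h g _; rewrite !diff_shear.
rewrite -[in RHS](row_nth_coord h) -[in RHS](row_nth_coord g).
rewrite (omega0_row (dshear_coord k d w z h) (dshear_coord k d w z g)).
rewrite (omega0_row (nth_coord h) (nth_coord g)).
rewrite !big_ord_recl !addrA; congr (_ + _); last first.
  apply: eq_bigr => i _.
  by have -> : (2 * lift ord0 (lift ord0 i) = (2 * i).+4)%N by rewrite !lift0; lia.
rewrite /= /bump /= muln0 muln1.
set x := nth_coord z 0; set y := nth_coord z 1; set u := nth_coord z 2.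
have iu0 : (1 + u ^+ 2)^-1 * (1 + u ^+ 2) = 1.
  by rewrite mulVf// gt_eqF// ltr_pwDl// sqr_ge0.
have cs := cos2Dsin2 (k * shearV z).
rewrite /drotX /drotY /rotX /rotY /dshearV.
move: iu0 cs; rewrite -/x -/y -/u.
set iu := (1 + u ^+ 2)^-1; set C := cos (k * _); set S := sin (k * _).
move: iu C S => iu C S iu0 cs; apply/eqP; rewrite -subr_eq0; apply/eqP.
(* [V] is the differential of [shearV]; [A] and [B] are the cofactors of the relations [cs] and
   [iu0] in the difference of the two sides. *)
pose V (h : 'rV[R]_(2 * n.+2)) := (1 + u ^+ 2) * nth_coord h 3 + 2 * u * nth_coord z 3 * nth_coord h 2.
pose A := nth_coord h 0 * nth_coord g 1 - nth_coord g 0 * nth_coord h 1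
  + k * ((x * nth_coord h 0 + y * nth_coord h 1) * V g
         - (x * nth_coord g 0 + y * nth_coord g 1) * V h).
pose B := nth_coord h 2 * nth_coord g 3 - nth_coord g 2 * nth_coord h 3.
transitivity ((C ^+ 2 + S ^+ 2 - 1) * A + (iu * (1 + u ^+ 2) - 1) * B).
  by rewrite /A /B /V; ring.
by rewrite cs iu0 subrr !mul0r addr0.
Qed.

End ShearSymplectic.

(** * The inverse of the shear, and its sections *)

Section ShearEmbedding.
Context {R : realType}.

(** Only the translation is undone here: on the image, [unrotX] and [unrotY] recover [rotX] and
    [rotY]. *)
Definition unrotX n (d w : R) (p : 'rV[R]_(2 * n)) : R :=
  nth_coord p 0 - d * cos (w * nth_coord p 3).

Definition unrotY n (d w : R) (p : 'rV[R]_(2 * n)) : R :=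
  nth_coord p 1 - d * sin (w * nth_coord p 3).

(** The shift of U is added back. The rotation preserves the norm, so the base point can stay
    rotated. *)
Definition unshearU n (k d w : R) (p : 'rV[R]_(2 * n)) : R :=
  nth_coord p 2 + k / 2 * (unrotX d w p ^+ 2 + unrotY d w p ^+ 2)
  + w * d * (cos (w * nth_coord p 3) * unrotX d w p
             + sin (w * nth_coord p 3) * unrotY d w p).

(** The base point is rotated back, and u = tan U, v = V cos^2 U because 1 + u^2 = 1 / cos^2 U. *)
Definition unshear_coord n (k d w : R) (p : 'rV[R]_(2 * n)) (j : nat) : R :=
  let c := cos (k * nth_coord p 3) in let s := sin (k * nth_coord p 3) in
  match j with
  | 0 => c * unrotX d w p + s * unrotY d w p
  | 1 => c * unrotY d w p - s * unrotX d w p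
  | 2 => tan (unshearU k d w p)
  | 3 => nth_coord p 3 * cos (unshearU k d w p) ^+ 2
  | _ => nth_coord p j
  end.

Definition unshear n (k d w : R) (p : 'rV[R]_(2 * n)) : 'rV[R]_(2 * n) :=
  \row_(i < 2 * n) unshear_coord k d w p i.

Lemma unshearU_shear n (k d w : R) (z : 'rV[R]_(2 * n)) : (2 <= n)%N ->
  unshearU k d w (shear k d w z) = atan (nth_coord z 2).
Proof.
move=> n2; rewrite /unshearU /unrotX /unrotY !nth_coord_row/=; try by lia.
rewrite !addrK /shearU.
by rewrite rot_norm; ring.
Qed.

Lemma shearK n (k d w : R) : (2 <= n)%N ->
  cancel (@shear R n k d w) (unshear k d w).
Proof.
move=> n2 z; rewrite -[RHS]row_nth_coord; apply/rowP => i; rewrite !mxE.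
have UE := unshearU_shear k d w z n2.
have cs := cos2Dsin2 (k * shearV z).
have cV : nth_coord (shear k d w z) 3 = shearV z by rewrite nth_coord_row//; lia.
have cX : unrotX d w (shear k d w z) = rotX k z.
  by rewrite /unrotX cV nth_coord_row/= ?addrK//; lia.
have cY : unrotY d w (shear k d w z) = rotY k z.
  by rewrite /unrotY cV nth_coord_row/= ?addrK//; lia.
have := ltn_ord i; move: (i : nat) => [|[|[|[|j]]]] hj /=.
- rewrite cV cX cY /rotX /rotY; move: cs; set C := cos _; set S := sin _ => cs.
  transitivity ((C ^+ 2 + S ^+ 2) * nth_coord z 0); first by ring.
  by rewrite cs mul1r.
- rewrite cV cX cY /rotX /rotY; move: cs; set C := cos _; set S := sin _ => cs.
  transitivity ((C ^+ 2 + S ^+ 2) * nth_coord z 1); first by ring.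
  by rewrite cs mul1r.
- by rewrite UE atanK.
- rewrite cV UE cos_atan exprVn sqr_sqrtr; last by rewrite addr_ge0// sqr_ge0.
  by rewrite /shearV mulfK// gt_eqF// ltr_pwDl// sqr_ge0.
- by rewrite nth_coord_row.
Qed.

Lemma differentiable_unshear n (k d w : R) (p : 'rV[R]_(2 * n)) :
  cos (unshearU k d w p) != 0 -> differentiable (unshear k d w) p.
Proof.
move=> cU0.
have D (f : 'rV[R]_(2 * n) -> R) : elementary f -> differentiable f p.
  by move=> /elementary_diff[df /(_ p)[]].
have EX : elementary (@unrotX n d w) by rewrite /unrotX; elementary_tac.
have EY : elementary (@unrotY n d w) by rewrite /unrotY; elementary_tac.
have EU : elementary (@unshearU n k d w) by rewrite /unshearU; elementary_tac.
apply: differentiable_row => i.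
move: (i : nat) => [|[|[|[|j]]]] /=.
- by apply: D; elementary_tac.
- by apply: D; elementary_tac.
- have /differentiableP DU := D _ EU.
  by case: (is_diff_comp_derive DU (is_derive_tan cU0)).
- by apply: D; elementary_tac.
- by apply: D; elementary_tac.
Qed.

(** The differential is injective because it preserves a nondegenerate form. The inverse is
    continuous on the image because there [unshearU] is a value of [atan], where [cos] is positive
    and [tan] is differentiable. *)
Lemma shear_symplectic n (k d w : R) : (2 <= n)%N ->
  symplectic_embedding setT (@shear R n k d w).
Proof.
move=> n2; split; last by move=> z _ u v; exact: shear_omega0.
split; first exact: shear_smooth.
- move=> z _ u1 u2 e; apply: omega0_nondegenerate => v.
  by rewrite -(shear_omega0 k d w z u1 v n2) e shear_omega0.
- exists (unshear k d w); split; first by move=> z _; exact: shearK.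
  apply: continuous_in_subspaceT => p /set_mem[z _ <-].
  apply: differentiable_continuous; apply: differentiable_unshear.
  rewrite unshearU_shear// gt_eqF//; apply: cos_gt0_pihalf.
  by rewrite atan_gtNpi2 atan_ltpi2.
Qed.

Lemma shear_into n (k d w : R) (S S' : set 'rV[R]_(2 * n)) : (2 <= n)%N ->
  (forall z, S z -> S' (shear k d w z)) ->
  symplectic_embedding_into S S' (shear k d w).
Proof.
move=> n2 hS; split; first by move=> _ [z Sz <-]; exact: hS.
by exists setT, (shear k d w); split => //; [exact: openT|exact: shear_symplectic].
Qed.

(** The fiber coordinates are numbered from 0, so the first two entries of [x] prescribe the
    coordinates 2 and 3 of the image, which are U and V. *)
Lemma base_section_shear n (k d w : R) (S : set 'rV[R]_(2 * n))
    (x : 'rV[R]_(2 * n - 2)) (p : R * R) : (2 <= n)%N ->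
  base_section (shear k d w) S x p ->
  exists z, [/\ S z, p = (shear_coord k d w z 0, shear_coord k d w z 1),
    p.1 ^+ 2 + p.2 ^+ 2 <= 1, shearU k d w z = nth_coord x 0
    & shearV z = nth_coord x 1].
Proof.
move=> n2 [_ [[z Sz <-] [pd <-]] <-]; exists z; split => //.
- by rewrite /base_proj /xcoord /ycoord !nth_coord_row//; lia.
- by move: pd; rewrite /disc /= divff// gt_eqF// pi_gt0.
- rewrite /fiber_proj (nth_coord_row (fun j => nth_coord _ (j + 2)%N)); last by lia.
  by rewrite nth_coord_row//; lia.
- rewrite /fiber_proj (nth_coord_row (fun j => nth_coord _ (j + 2)%N)); last by lia.
  by rewrite nth_coord_row//; lia.
Qed.

End ShearEmbedding.

(** * Embeddings with small sections *)

Section SmallSections.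
Context {R : realType}.

Lemma inf_sup_eq0 n (nu : set (R * R) -> \bar R) (S : set 'rV[R]_(2 * n)) :
  (forall T, 0 <= nu T)%E ->
  (forall eta : R, 0 < eta <= 2^-1 ->
    exists2 phi, symplectic_embedding_into S (@cylinder R n pi) phi &
      forall x, (nu (base_section phi S x) <= (12 * eta)%:E)%E) ->
  inf_sup nu S = 0%E.
Proof.
move=> nu0 H; apply/eqP; rewrite eq_le; apply/andP; split; last first.
  (* The supremum is nonnegative because the fiber over 0 contributes to it. *)
  apply: le_ereal_inf_tmp => _ [phi _ <-].
  by apply: le_trans (nu0 _) _; apply: ereal_sup_ubound; exists 0.
apply/lee_addgt0Pr => e e0; rewrite add0e.
have [|phi hphi nuphi] := H (Num.min (2^-1) (e / 12)).
  by rewrite lt_min ge_min lexx invr_gt0 ltr0n divr_gt0//.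
apply: (@le_trans _ _ (ereal_sup [set nu (base_section phi S x) | x in setT])).
  by apply: ereal_inf_lbound; exists phi.
apply: ge_ereal_sup => _ [x _ <-]; apply: le_trans (nuphi x) _.
have : Num.min (2^-1) (e / 12) <= e / 12 by rewrite ge_min lexx orbT.
by rewrite lee_fin; lra.
Qed.

Lemma cylinderE n (z : 'rV[R]_(2 * n)) :
  cylinder n pi z <-> nth_coord z 0 ^+ 2 + nth_coord z 1 ^+ 2 <= 1.
Proof.
by rewrite /cylinder /disc /= divff ?gt_eqF ?pi_gt0// /base_proj /xcoord /ycoord muln0.
Qed.

Lemma sqr_le1 (a b : R) : a ^+ 2 + b ^+ 2 <= 1 -> -1 <= a <= 1.
Proof. by move=> h; have := sqr_ge0 b; nra. Qed.

Lemma sigma_eq0 n (S : set 'rV[R]_(2 * n)) : (2 <= n)%N ->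
  S `<=` cylinder n pi -> sigma S = 0%E.
Proof.
move=> n2 hS; apply: inf_sup_eq0 => [T|eta /andP[eta0 _]].
  by apply: mu_ext_ge0 => T'; exact: mu2_ge0.
have pi0 : (0 : R) < pi := pi_gt0 R.
(* With this [k] the squared radius varies by at most [2 / k * pi = eta ^+ 2] on a fiber; [m] below
   is its value for atan u = - pi / 2. *)
pose k := 2 * pi / eta ^+ 2.
have eta2 : 0 < eta ^+ 2 by rewrite exprn_gt0.
have k0 : 0 < k by rewrite !mulr_gt0// invr_gt0.
exists (shear k 0 0).
  apply: shear_into => // z /hS/cylinderE h; apply/cylinderE.
  by rewrite !nth_coord_row/= ?mul0r ?addr0 ?rot_norm//; lia.
move=> x; pose m := 2 / k * (- (pi / 2) - nth_coord x 0).
apply: (@le_trans _ _ (4 * eta)%:E); last by rewrite lee_fin; lra.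
apply: (@outer_mu2_annulus_le _ _ m) => // p.
move=> /base_section_shear-/(_ n2)[z [Sz -> /= p1 hU _]].
split; first exact: sqr_le1 p1.
rewrite !mul0r !addr0 rot_norm.
have /andP[t1 t2] : - (pi / 2) < atan (nth_coord z 2) < pi / 2.
  by rewrite atan_gtNpi2 atan_ltpi2.
set r := _ + _; move: hU; rewrite /shearU !mul0r subr0 -/r => hU.
have rE : r = 2 / k * (atan (nth_coord z 2) - nth_coord x 0).
  by rewrite -hU; field; rewrite gt_eqF.
have k2 : 0 < 2 / k by rewrite divr_gt0.
have -> : eta ^+ 2 = 2 / k * pi by rewrite /k; move: (pi : R) pi0 => q q0; field; rewrite !gt_eqF.
have := ltW t1; rewrite -(lerD2r (- nth_coord x 0)) -(ler_pM2l k2) => r1.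
have := ltW t2; rewrite -(lerD2r (- nth_coord x 0)) -(ler_pM2l k2) => r2.
by rewrite rE /m r1 /=; lra.
Qed.

(** The intersection of the square and the strip is cut out by six half-planes, each of which
    contains the hull. *)
Lemma sc_hull_mu_strip_le (T : set (R * R)) (c s m eta : R) :
  c ^+ 2 + s ^+ 2 = 1 -> 0 < eta <= 2^-1 ->
  (forall p, T p -> [/\ -1 <= p.1 <= 1, -1 <= p.2 <= 1
     & m <= c * p.1 + s * p.2 <= m + eta ^+ 2]) ->
  (sc_hull_mu T <= (12 * eta)%:E)%E.
Proof.
move=> cs heta hT; apply: (@mu2_strip_le _ _ c s m) => // p Hp.
have hull a b l : (a, b) != (0, 0) ->
    (forall p, T p -> a * p.1 + b * p.2 <= l) -> a * p.1 + b * p.2 <= l.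
  by move=> ab0 hl; exact: sc_hull_halfplane ab0 hl _ Hp.
have cs0 : (c, s) != (0, 0).
  apply/negP => /eqP[c0 s0]; move: cs; rewrite c0 s0 expr0n /= addr0 => /eqP.
  by rewrite eq_sym oner_eq0.
have x1 := hull 1 0 1; have x2 := hull (-1) 0 1.
have y1 := hull 0 1 1; have y2 := hull 0 (-1) 1.
have l1 := hull c s (m + eta ^+ 2) cs0; have l2 := hull (- c) (- s) (- m).
rewrite !xpair_eqE ?oppr_eq0 ?oner_eq0 ?eqxx -?xpair_eqE /= in x1 x2 y1 y2 l2.
have {}x1 : 1 * p.1 + 0 * p.2 <= 1 by apply: x1 => // q /hT[]; lra.
have {}x2 : -1 * p.1 + 0 * p.2 <= 1 by apply: x2 => // q /hT[]; lra.
have {}y1 : 0 * p.1 + 1 * p.2 <= 1 by apply: y1 => // q /hT[]; lra.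
have {}y2 : 0 * p.1 + -1 * p.2 <= 1 by apply: y2 => // q /hT[]; lra.
have {}l1 : c * p.1 + s * p.2 <= m + eta ^+ 2 by apply: l1 => q /hT[]; lra.
have {}l2 : - c * p.1 + - s * p.2 <= - m by apply: l2 => // q /hT[]; lra.
by split; lra.
Qed.

Lemma sigma_hat_eq0 n (S : set 'rV[R]_(2 * n)) (a : R) : (2 <= n)%N ->
  a < pi -> S `<=` cylinder n a -> sigma_hat S = 0%E.
Proof.
move=> n2 api hS; apply: inf_sup_eq0 => [T|eta heta]; first exact: mu2_ge0.
have /andP[eta0 eta2] := heta.
have pi0 : (0 : R) < pi := pi_gt0 R.
pose q := a / pi; have q1 : q < 1 by rewrite ltr_pdivrMr// mul1r.
(* [q] is the squared radius of the disc of area [a]. For [q >= 0] one has [d <= 1 / 3], so the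
   translated point has squared norm at most q + 2 d + d^2 <= q + 3 d = 1. *)
pose d := (1 - q) / 3; have d0 : 0 < d by rewrite divr_gt0// subr_gt0.
(* Chosen so that the strip has width [pi / (w * d) = eta ^+ 2]. *)
pose w := pi / (d * eta ^+ 2).
have etaE : 0 < eta ^+ 2 by rewrite exprn_gt0.
have w0 : 0 < w by rewrite divr_gt0// mulr_gt0.
have rot0 z : @rotX R n 0 z = nth_coord z 0 /\ @rotY R n 0 z = nth_coord z 1.
  by rewrite /rotX /rotY !mul0r cos0 sin0 !mul1r !mul0r subr0 add0r.
exists (shear 0 d w).
  apply: shear_into => // z /hS h; apply/cylinderE.
  rewrite !nth_coord_row/=; try by lia.
  have [-> ->] := rot0 z; have := cos2Dsin2 (w * shearV z).
  move: h; rewrite /cylinder /disc /base_proj /xcoord /ycoord /= muln0.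
  rewrite -/q; move: (nth_coord z 0) (nth_coord z 1) (cos _) (sin _).
  move=> X Y c s h cs.
  (* A negative [a] is allowed, but then the disc has no points. *)
  have q0 : 0 <= q by apply: le_trans h; rewrite addr_ge0// sqr_ge0.
  have t1 : c * X + s * Y <= 1.
    have : 0 <= (c - X) ^+ 2 + (s - Y) ^+ 2 by rewrite addr_ge0// sqr_ge0.
    by rewrite /d in d0; lra.
  have dt : d * (c * X + s * Y) <= d * 1 by rewrite ler_pM2l.
  have d3 : d * d <= d * (1 / 3) by rewrite ler_pM2l// /d; lra.
  have -> : (X + d * c) ^+ 2 + (Y + d * s) ^+ 2 =
      X ^+ 2 + Y ^+ 2 + 2 * (d * (c * X + s * Y)) + d * d * (c ^+ 2 + s ^+ 2).
    by ring.
  by rewrite cs; rewrite /d in d0 dt d3 *; lra.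
move=> x; set V := nth_coord x 1; pose c := cos (w * V); pose s := sin (w * V).
(* The direction [(c, s)] is constant on the fiber. The summand [d] is the value of the linear form
   on the translation vector [d * (c, s)]; the rest corresponds to atan u = - pi / 2. *)
pose m := d + (- (pi / 2) - nth_coord x 0) / (w * d).
apply: (@sc_hull_mu_strip_le _ c s m) => //; first exact: cos2Dsin2.
move=> p /base_section_shear-/(_ n2)[z [Sz -> /= p1 hU hV]].
split; [exact: sqr_le1 p1|by rewrite addrC in p1; exact: sqr_le1 p1|].
move: hU; rewrite /shearU; have [-> ->] := rot0 z; rewrite hV -/V -/c -/s.
rewrite !mul0r subr0 => hU.
have /andP[t1 t2] : - (pi / 2) < atan (nth_coord z 2) < pi / 2.
  by rewrite atan_gtNpi2 atan_ltpi2.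
have cs : c ^+ 2 + s ^+ 2 = 1 := cos2Dsin2 _.
have wd0 : 0 < w * d by rewrite mulr_gt0.
have lE : c * (nth_coord z 0 + d * c) + s * (nth_coord z 1 + d * s) =
    d + (atan (nth_coord z 2) - nth_coord x 0) / (w * d).
  have -> : atan (nth_coord z 2) - nth_coord x 0 =
      (c * nth_coord z 0 + s * nth_coord z 1) * (w * d) by rewrite -hU; ring.
  rewrite mulfK ?gt_eqF//.
  transitivity (d * (c ^+ 2 + s ^+ 2) + (c * nth_coord z 0 + s * nth_coord z 1)).
    by ring.
  by rewrite cs mulr1.
have -> : eta ^+ 2 = pi / (w * d) by rewrite /w; move: (pi : R) pi0 => r r0; field; rewrite !gt_eqF.
have wdi : 0 < (w * d)^-1 by rewrite invr_gt0.
have := ltW t1; rewrite -(lerD2r (- nth_coord x 0)) -(ler_pM2r wdi) => r1.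
have := ltW t2; rewrite -(lerD2r (- nth_coord x 0)) -(ler_pM2r wdi) => r2.
by rewrite lE /m lerD2l r1 /=; lra.
Qed.

End SmallSections.

Theorem theorem2p1 (R : realType) (n : nat) (hn : (2 <= n)%N)
    (S : set 'rV[R]_(2 * n)) (hS : S `<=` cylinder n pi) :
  sigma S = 0%E /\
  ((exists2 a : R, a < pi & S `<=` cylinder n a) -> sigma_hat S = 0%E).
Proof.
split; first exact: sigma_eq0.
by move=> [a api hSa]; exact: sigma_hat_eq0 hSa.
Qed.
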